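(* Let $F_n$ be the free group of finite rank $n\geqslant 2$ and let $\theta:F_n\to F_n$ be an injective endomorphism. Let $w\in F_n\setminus\{e\}$ be such that $\theta(w)=w^d$ for some integer $d$ with $|d|\geqslant 2$, and suppose that $w$ is not a proper power in $F_n$. Then $w$ is primitive in $F_n$.
   Context: An element of a free group $F$ is primitive in $F$ if it is a member of some free basis of $F$. An element $w$ is a proper power if $w=u^k$ for some $u\in F$ and some $k\geqslant 2$. *)

(* Defs.v *)
From mathcomp Require Import all_boot all_order all_algebra.

Set Implicit Arguments.
Unset Strict Implicit.
Unset Printing Implicit Defensive.

Local Open Scope group_scope.

(* Universal property: every map from B to a group H extends uniquely to a
   morphism G -> H.  A map B -> H is given as a map f on all of G, of which only
   the values on B matter.  A multiplicative map between groups preserves 1. *)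
Definition free_basis (G : groupType) (B : G -> Prop) : Prop :=
  forall (H : groupType) (f : G -> H),
    exists2 phi : {multiplicative G -> H},
      (forall b, B b -> phi b = f b)
    & forall psi : {multiplicative G -> H},
        (forall b, B b -> psi b = f b) -> psi =1 phi.

Definition free_of_rank (G : groupType) (n : nat) : Prop :=
  exists2 s : n.-tuple G, uniq s & free_basis (fun x => x \in s).

Definition primitive (G : groupType) (w : G) : Prop :=
  exists2 B : G -> Prop, free_basis B & B w.

Definition proper_power (G : groupType) (w : G) : Prop :=
  exists (u : G) (k : nat), (2 <= k)%N /\ w = u ^+ k.

(* Integer powers; Negz m stands for the integer - m.+1. *)
Definition expgz (G : groupType) (x : G) (d : int) : G :=
  match d with
  | Posz m => x ^+ m
  | Negz m => x ^- m.+1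
  end.

(* Main.v *)
(* Let K be the image of Theta, a power of theta with Theta w = w^N and N >= n.  In the
   covering graph of the rose with vertices the cosets K \ F, the power w^N is a closed
   path at the base point.  If it crosses some edge exactly once, then a Schreier basis
   of K, taken for a spanning tree that omits this edge, can be modified to contain w^N;
   as Theta is an isomorphism from F onto K, w is primitive in F.

   Otherwise every edge of the path is crossed at least twice, and the stacking argument
   of Louder and Wilton applies.  The bi-invariant order of F given by Magnus expansions
   orders the cyclic conjugates of w, which are distinct as w is not a proper power.  It
   lifts the path to an embedded curve in the product of the covering graph with a line.
   The part of the curve seen from above is a union of open arcs, at least one for each of
   the N turns around w: the highest point of w is seen, but the edges at the lowest point
   are not, since each of them has another strand above it.  The number of these arcs is
   minus the Euler characteristic of the graph spanned by the path, hence at most n - 1,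
   contradicting N >= n. *)
From HB Require Import structures.
Require Import Defs.
From mathcomp Require Import all_boot all_order all_algebra.
From mathcomp Require Import boolp zify.

Set Implicit Arguments.
Unset Strict Implicit.
Unset Printing Implicit Defensive.

Import GRing.Theory Num.Theory Order.TTheory.

Lemma ex_min_nat (P : nat -> Prop) :
  (exists n, P n) -> exists2 n, P n & forall m, P m -> n <= m.
Proof.
move=> exP; have exb : exists n, `[<P n>] by case: exP => n Pn; exists n; apply/asboolP.
exists (ex_minn exb); first by case: ex_minnP => n /asboolP.
by case: ex_minnP => n _ minn m Pm; apply/minn/asboolP.
Qed.

(** * Numbering of words *)

Section Code.

Variable A : finType.
Implicit Types (s t : seq A) (a : A).

(* Numerals in base #|A| + 1 without zero digits: this makes [code] injective and
   increasing in the length. *)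
Definition code s : nat :=
  foldl (fun m a => m * #|A|.+1 + (enum_rank a).+1) 0 s.

Lemma code_rcons s a :
  code (rcons s a) = code s * #|A|.+1 + (enum_rank a).+1.
Proof. by rewrite /code foldl_rcons. Qed.

Lemma code_inj : injective code.
Proof.
elim/last_ind=> [|s a IHs] t; first by case/lastP: t => // t b; rewrite code_rcons addnS.
case/lastP: t => [|t b]; first by rewrite code_rcons addnS.
have ltA (c : A) : (enum_rank c).+1 < #|A|.+1 by rewrite ltnS ltn_ord.
rewrite !code_rcons => eq_st.
have /IHs-> : code s = code t.
  have := congr1 (divn^~ #|A|.+1) eq_st.
  by rewrite /= !divnMDl // !divn_small // !addn0.
have := congr1 (modn^~ #|A|.+1) eq_st.
rewrite /= !modnMDl !modn_small //.
by case=> /val_inj/enum_rank_inj->.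
Qed.

Lemma ltn_code_rcons s t a : code s < code t -> code (rcons s a) < code (rcons t a).
Proof. by rewrite !code_rcons ltn_add2r ltn_pmul2r. Qed.

Lemma ltn_size_code s t : size s < size t -> code s < code t.
Proof.
have ub r : code r < #|A|.+1 ^ size r.
  elim/last_ind: r => // r a IHr; rewrite code_rcons size_rcons expnSr.
  apply: (@leq_trans ((code r).+1 * #|A|.+1)); last by rewrite leq_pmul2r.
  by rewrite mulSn addnC -addSn leq_add2r ltnS ltn_ord.
have lb r a : #|A|.+1 ^ size r <= code (rcons r a).
  elim/last_ind: r a => [|r b IHr] a; first by rewrite code_rcons /=; lia.
  rewrite [in leqRHS]code_rcons size_rcons expnSr; apply: leq_trans (leq_addr _ _).
  by rewrite leq_pmul2r ?IHr.
case/lastP: t => // t a; rewrite size_rcons ltnS => le_st.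
apply: leq_trans (ub s) _; apply: leq_trans (lb t a).
by rewrite leq_pexp2l.
Qed.

End Code.

(** * Magnus expansions *)

Section Magnus.

Variable X : finType.
Implicit Types (f g : seq X -> int) (s t : seq X) (x y : X) (b : bool).
Local Open Scope ring_scope.

(** The lexicographic order on power series, with monomials listed by [code]. Shorter monomials come
    first, which [flt_conj] relies on. *)
Definition flt f g : Prop :=
  exists2 s, f s < g s & forall t, (code t < code s)%N -> f t = g t.

Lemma flt_irr f : ~ flt f f.
Proof. by case=> s; rewrite ltxx. Qed.

Lemma flt_trans f g k : flt f g -> flt g k -> flt f k.
Proof.
case=> s lt_s eq_s [t lt_t eq_t]; case: (ltngtP (code s) (code t)) => [st|ts|/code_inj st].
- by exists s => [|r rs]; [rewrite -eq_t | rewrite eq_s ?eq_t // (ltn_trans rs)].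
- by exists t => [|r rt]; [rewrite eq_s | rewrite eq_s ?eq_t // (ltn_trans rt)].
- rewrite -{}st in lt_t eq_t.
  by exists s => [|r rs]; [apply: lt_trans lt_t | rewrite eq_s ?eq_t].
Qed.

Lemma flt_total f g : f <> g -> flt f g \/ flt g f.
Proof.
move=> neq_fg.
have [m [s fgs <-] min_s] : exists2 m, (exists2 s, f s <> g s & code s = m)
    & forall m', (exists2 s, f s <> g s & code s = m') -> (m <= m')%N.
  apply: ex_min_nat; apply: contrapT => no_s; apply/neq_fg/funext => s.
  by apply: contrapT => fgs; apply: no_s; exists (code s), s.
have eq_lt t : (code t < code s)%N -> f t = g t.
  move=> ts; apply: contrapT => fgt.
  by move: ts; rewrite ltnNge min_s //; exists t.
by case: (ltgtP (f s) (g s)) => // lt_s; [left|right]; exists s => // t /eq_lt.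
Qed.

(* Functions [seq X -> int] stand for power series in noncommuting variables; [mulL],
   [mulR] and [divL] are the left and right multiplications by [1 + x] and the left
   multiplication by its inverse. *)
Definition mulL x f s : int :=
  if s is y :: t then f s + (if y == x then f t else 0) else f s.

Definition mulR x f s : int := mulL x (f \o rev) (rev s).

Fixpoint divL x f s : int :=
  if s is y :: t then f s - (if y == x then divL x f t else 0) else f s.

Lemma mulLK x f : divL x (mulL x f) = f.
Proof.
apply/funext; elim=> //= y t ->; case: ifP => _; rewrite ?addrK ?addr0 ?subr0 //.
Qed.

Lemma divLK x f : mulL x (divL x f) = f.
Proof. by apply/funext; case=> //= y t; rewrite subrK. Qed.

Lemma mulR_rcons x f s y :
  mulR x f (rcons s y) = f (rcons s y) + (if y == x then f s else 0).
Proof. by rewrite /mulR rev_rcons /= rev_cons revK. Qed.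

Lemma mulLR x y f : mulL x (mulR y f) = mulR y (mulL x f).
Proof.
apply/funext=> s; case/lastP: s => // -[|z s] t.
  rewrite mulR_rcons /= -[[:: t]]/(rcons [::] t) mulR_rcons /= /mulR /=.
  by case: ifP; case: ifP => // _ _; rewrite ?addr0 // addrAC.
rewrite mulR_rcons /= -[z :: rcons s t]/(rcons (z :: s) t) !mulR_rcons.
by case: (z == x); case: (t == y); rewrite ?addr0 // !addrA; congr (_ + _); rewrite addrAC.
Qed.

Definition mulX (l : X * bool) := if l.2 then mulL l.1 else divL l.1.

Lemma mulXK x b f : mulX (x, b) (mulX (x, ~~ b) f) = f.
Proof. by case: b; rewrite /mulX /= ?mulLK ?divLK. Qed.

Lemma mulX_inj l : injective (mulX l).
Proof.
case: l => x b; apply: (can_inj (g := mulX (x, ~~ b))) => f.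
by rewrite -[in RHS](mulXK x (~~ b) f) negbK.
Qed.

Lemma mulXR l y f : mulX l (mulR y f) = mulR y (mulX l f).
Proof.
case: l => x [] /=; rewrite /mulX /= ?mulLR //.
by rewrite -[in LHS](divLK x f) -mulLR mulLK.
Qed.

Definition magnus (u : seq (X * bool)) : seq X -> int :=
  foldr mulX (fun s => (s == [::])%:R) u.

Lemma magnus_rconsT u x : magnus (rcons u (x, true)) = mulR x (magnus u).
Proof.
elim: u => [|l u /= ->]; last by rewrite mulXR.
apply/funext=> s; rewrite /magnus /= /mulX /=; case/lastP: s => // -[|y s] z.
  by rewrite -[in RHS]/(rcons [::] z) mulR_rcons.
rewrite mulR_rcons /=; case: s => [|? ?] /=; by do 2 case: ifP.
Qed.

Lemma magnus_rconsF u x : mulR x (magnus (rcons u (x, false))) = magnus u.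
Proof.
elim: u => [|l u /= <-]; last by rewrite -mulXR.
rewrite -mulXR -(magnus_rconsT [::] x) /=.
exact: (mulXK x false).
Qed.

(* Conjugation by [1 + x] does not affect the terms of lowest degree. *)
Lemma flt_conj x f g f' g' :
  mulL x f' = mulR x f -> mulL x g' = mulR x g -> flt f g <-> flt f' g'.
Proof.
move=> eqf eqg.
have diff s : (forall t, (size t < size s)%N -> f t = g t /\ f' t = g' t) ->
    g s - f s = g' s - f' s.
  move/(congr1 (fun k => k s)): eqf; move/(congr1 (fun k => k s)): eqg.
  case/lastP: s => [|s z]; first by rewrite /mulR /= => -> ->.
  rewrite !mulR_rcons => eg ef lo.
  have [|_ ?] := lo (behead (rcons s z)); first by rewrite size_behead size_rcons.
  have [|? _] := lo s; first by rewrite size_rcons.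
  move: eg ef; rewrite headI /=; do 2 case: ifP => _; lia.
(* By [diff] and induction on the length, agreement below [s] passes from either of the pairs [f, g]
   and [f', g'] to the other. *)
have low s : (forall t, (code t < code s)%N -> f t = g t) \/
     (forall t, (code t < code s)%N -> f' t = g' t) ->
   forall t, (code t < code s)%N -> f t = g t /\ f' t = g' t.
  move=> lo t; have [m] := ubnP (size t); elim: m t => // m IHm t; rewrite ltnS => tm ts.
  have dt : g t - f t = g' t - f' t.
    by apply: diff => r rt; apply: IHm; [lia | apply: ltn_trans ts; apply: ltn_size_code].
  by case: lo => lo; have := lo t ts; lia.
have at_s s : (forall t, (code t < code s)%N -> f t = g t /\ f' t = g' t) ->
    g s - f s = g' s - f' s by move=> lo; apply: diff => t /ltn_size_code/lo.
split=> -[s lt_s eq_s].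
- have lo := low s (or_introl eq_s); exists s => [|t /lo[]//].
  by have := at_s s lo; lia.
- have lo := low s (or_intror eq_s); exists s => [|t /lo[]//].
  by have := at_s s lo; lia.
Qed.

Implicit Types (l : X * bool) (u v : seq (X * bool)).

Definition opp_letter l := (l.1, ~~ l.2).

Lemma opp_letterK : involutive opp_letter.
Proof. by case=> x b; rewrite /opp_letter negbK. Qed.

Definition reduced u := sorted (fun l l' => l' != opp_letter l) u.

Let alt := sorted (fun x y : X => x != y).

Let alt_ohead x t : alt (x :: t) -> ohead t != Some x.
Proof. by case: t => //= y t /andP[neq_xy _]; apply/eqP=> -[eyx]; rewrite eyx eqxx in neq_xy. Qed.

Definition sign l : int := if l.2 then 1 else -1.

Lemma mulX_cons l f t :
  ohead t != Some l.1 -> mulX l f (l.1 :: t) = f (l.1 :: t) + sign l * f t.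
Proof.
rewrite /mulX /sign; case: l => x [] /= ht; rewrite eqxx ?mul1r // mulN1r; congr (_ - _).
by case: t ht => //= y t /eqP ht; case: eqP => [eyx|]; rewrite ?subr0 //; case: ht; rewrite eyx.
Qed.

Lemma mulX_ncons l f t : ohead t != Some l.1 -> mulX l f t = f t.
Proof.
case: l t => x [] [|y t] //= /eqP ht; rewrite /mulX /=;
  by case: eqP => [eyx|]; rewrite ?addr0 ?subr0 //; case: ht; rewrite eyx.
Qed.

(* The leading coefficients of a reduced word x1^e1 ... xk^ek at monomials without equal
   adjacent variables: that of x1 ... xk is e1 times that of x2 ... xk, which is nonzero. *)
Let leading l f := exists t (e : int),
  [/\ alt (l.1 :: t), 0 < e, f t != 0, f (l.1 :: t) = sign l * e * f t &
    forall s, alt s -> (size t < size s)%N ->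
      (size s = (size t).+1 -> ohead s != Some l.1) -> f s = 0].

(** The case where the letter opens a new block: the exponent is [1], and the old leading monomial
    [t] supplies the nonzero coefficient. *)
Lemma leading_new l f t :
    alt (l.1 :: t) -> f t != 0 ->
    (forall s, alt s -> (size t < size s)%N -> f s = 0) ->
  leading l (mulX l f).
Proof.
move=> alt_t ft0 f0.
have ht := alt_ohead alt_t.
exists t, 1; split; rewrite ?mulX_cons ?mulX_ncons //.
  by rewrite f0 ?add0r ?mulr1 //=.
move=> s alt_s ts hs; case: (boolP (ohead s == Some l.1)) => [|?]; last by rewrite mulX_ncons ?f0.
case: s alt_s ts hs => // y s alt_s ts hs /eqP[eyl]; rewrite {y}eyl in alt_s ts hs *.
rewrite mulX_cons ?alt_ohead // f0 // f0 ?mulr0 //; first exact: path_sorted alt_s.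
by move: ts hs; rewrite /= eqxx ltnS leq_eqVlt => /predU1P[<- /(_ erefl)//|//].
Qed.

Lemma leading_magnus l u : reduced (l :: u) -> leading l (magnus (l :: u)).
Proof.
elim: u l => [|l' u IHu] l red_u.
  rewrite -[magnus _]/(mulX l (magnus [::])).
  by apply: (@leading_new _ _ [::]) => // -[].
have [t [e [alt_t e0 ft0 ft f0]]] := IHu l' (path_sorted red_u).
rewrite -[magnus _]/(mulX l (magnus (l' :: u))).
move: (magnus _) => f in ft0 ft f0 *.
have sl k : (sign k == 0) = false by rewrite /sign; case: ifP.
have [ell|nell] := eqVneq l.1 l'.1; last first.
  apply: (@leading_new _ _ (l'.1 :: t)) => //=; first by rewrite nell.
    by rewrite ft !mulf_eq0 negb_or ft0 sl gt_eqF.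
  by move=> s alt_s ts; apply: f0 => // [|es]; [exact: ltnW | move: ts; rewrite es ltnn].
(* By reducedness, equal variables carry equal signs; the first block grows and its exponent passes
   from [e] to [e + 1]. *)
have eqll : l = l'.
  move: red_u; rewrite /reduced /= => /andP[/eqP + _].
  case: l l' ell {IHu alt_t ft f0} => x b [y b'] /= ->; rewrite /opp_letter /=.
  by case: b b' => [] [].
rewrite -{l' ell IHu red_u}eqll in alt_t ft f0 *.
have ht := alt_ohead alt_t.
exists t, (e + 1); split; rewrite ?mulX_cons ?mulX_ncons ?addr_gt0 //.
  by rewrite ft mulrDr mulr1 mulrDl.
move=> s alt_s ts hs; case: (boolP (ohead s == Some l.1)) => [|?]; last by rewrite mulX_ncons ?f0.
case: s alt_s ts hs => // y s alt_s ts hs /eqP[eyl]; rewrite {y}eyl in alt_s ts hs *.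
have hhs := alt_ohead alt_s.
rewrite mulX_cons // f0 // f0 ?mulr0 //; first exact: path_sorted alt_s.
by move: ts hs; rewrite /= eqxx ltnS leq_eqVlt => /predU1P[<- /(_ erefl)//|//].
Qed.

Lemma magnus_neq1 u : reduced u -> u != [::] -> magnus u <> magnus [::].
Proof.
case: u => // l u /leading_magnus[t [e [_ e0 ft0 ft _]]] _ eq1.
have /eqP : magnus (l :: u) (l.1 :: t) = 0 by rewrite eq1.
by rewrite ft !mulf_eq0 (negPf ft0) orbF (gt_eqF e0) orbF /sign; case: ifP.
Qed.

Definition inv_word u := rev (map opp_letter u).

Lemma magnus_cat u v : magnus (u ++ v) = foldr mulX (magnus v) u.
Proof. exact: foldr_cat. Qed.

Lemma magnus_invK u v : magnus (inv_word u ++ u ++ v) = magnus v.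
Proof.
elim: u => //= l u IHu; rewrite /inv_word /= rev_cons cat_rcons magnus_cat /=.
rewrite -[opp_letter l]/(l.1, ~~ l.2) -[in X in mulX _ (mulX X _)](opp_letterK l).
by rewrite [X in foldr _ X _](mulXK l.1 (~~ l.2)) -magnus_cat IHu.
Qed.

(** Common first letters cancel. If the first letters differ, the inverse of one word followed by
    the other is reduced and nonempty, yet would have a trivial expansion. *)
Lemma magnus_inj u v : reduced u -> reduced v -> magnus u = magnus v -> u = v.
Proof.
elim: u v => [|l u IHu] [|k v] red_u red_v //.
- by move/esym/magnus_neq1 => []//.
- by move/magnus_neq1 => []//.
have [-> /mulX_inj/(IHu v (path_sorted red_u) (path_sorted red_v))-> //|nlk eq_uv] := eqVneq l k.
have red_catrev p q : reduced p -> reduced q ->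
    (forall l1 l2, ohead p = Some l1 -> ohead q = Some l2 -> l1 <> l2) ->
    reduced (catrev (map opp_letter p) q).
  elim: p q => //= l1 p IHp q red_p red_q neq; apply: IHp (path_sorted red_p) _ _.
    case: q red_q neq => //= l2 q red_q neq; rewrite /reduced /= opp_letterK.
    by rewrite red_q andbT eq_sym; apply/eqP/neq.
  case: p red_p => //= l3 p /andP[/eqP neq3 _] _ _ [<-] [<-] //.
have /magnus_neq1[] : reduced (inv_word (l :: u) ++ k :: v).
  by rewrite /inv_word -catrevE; apply: red_catrev => // _ _ [<-] [<-]; apply/eqP.
  by rewrite -size_eq0 size_cat addnS.
by rewrite magnus_cat -eq_uv -magnus_cat -[l :: u]cats0 -[in RHS](magnus_invK (l :: u)) cats0.
Qed.

End Magnus.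

(** * Heights of the rotations of a cyclic word *)

Section Stacking.

Variable X : finType.
Variables (l0 : X * bool) (u : seq (X * bool)).

Definition letter (i : nat) : X * bool := nth l0 u (i %% size u).
(* The [i]-th letter leads from position [i] to position [i + 1]; [src] and [tgt] are the
   ends of its edge in the direction of the generator. *)
Definition src (i : nat) : nat := i + ~~ (letter i).2.
Definition tgt (i : nat) : nat := i + (letter i).2.

Let f i := magnus (rot (i %% size u) u).

Lemma rot_letter i : u != [::] ->
  exists2 v, rot (i %% size u) u = letter i :: v &
             rot (i.+1 %% size u) u = rcons v (letter i).
Proof.
rewrite -size_eq0 -lt0n => u0; have := ltn_pmod i u0; rewrite /letter => ltiu.
exists (drop (i %% size u).+1 u ++ take (i %% size u) u).
  by rewrite /rot (drop_nth l0).
transitivity (rot (i %% size u).+1 u); last first.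
  by rewrite /rot (take_nth l0) // rcons_cat.
rewrite -addn1 -modnDml addn1; case: (ltngtP (i %% size u).+1 (size u)) => [?||->].
- by rewrite modn_small.
- by move=> lt_ui; rewrite ltnS leqNgt ltiu in lt_ui.
- by rewrite modnn rot0 rot_size.
Qed.

(** Moving along an edge conjugates the rotation by the generator of that edge; this is the form
    that [flt_conj] takes as input. *)
Lemma magnus_src_tgt i : u != [::] ->
  mulL (letter i).1 (f (tgt i)) = mulR (letter i).1 (f (src i)).
Proof.
move=> /(rot_letter i)[v ei ei1]; rewrite /f /src /tgt.
move: ei ei1; case: (letter i) => x [] /= ei ei1; rewrite addn1 addn0 ei ei1.
  by rewrite magnus_rconsT mulLR.
by rewrite magnus_rconsF; apply: divLK.
Qed.

(* The circle mapped to the rose by the cyclic word [u] is embedded in the product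
   of the rose with a line; [h] gives the heights of its vertices. *)
Lemma stacking :
    (forall i, reduced (rot i u)) ->
    (forall i j, i < size u -> j < size u -> rot i u = rot j u -> i = j) ->
  u != [::] -> exists h : nat -> nat,
    [/\ forall i, h (i %% size u) = h i,
        forall i j, h i = h j -> i = j %[mod size u] &
        forall i j, (letter i).1 = (letter j).1 ->
          (h (src i) < h (src j)) = (h (tgt i) < h (tgt j))].
Proof.
move=> red_u rot_inj u0; have u_gt0 : 0 < size u by rewrite lt0n size_eq0.
(* The height is the rank of the rotation in the Magnus order. *)
pose h i := #|[set j : 'I_(size u) | `[<flt (f j) (f i)>]]|.
have fm i : f (i %% size u) = f i by rewrite /f modn_mod.
have h_lt i j : flt (f i) (f j) -> h i < h j.
  move=> fij; apply: proper_card; apply/properP; split.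
    by apply/subsetP=> k; rewrite !inE => /asboolP fki; apply/asboolP/(flt_trans fki).
  exists (Ordinal (ltn_pmod i u_gt0)); rewrite !inE /= fm; first exact/asboolP.
  by apply/asboolP/flt_irr.
have f_inj i j : f i = f j -> i = j %[mod size u].
  by move/(magnus_inj (red_u _) (red_u _))/rot_inj; apply; rewrite ltn_pmod.
have h_ltE i j : (h i < h j) = `[<flt (f i) (f j)>].
  apply/idP/asboolP => [|/h_lt//]; case: (pselect (f i = f j)) => [fij|].
    by rewrite /h fij ltnn.
  by case/flt_total => // /h_lt; lia.
exists h; split=> [i|i j hij|i j eqx].
- by rewrite /h fm.
- apply: f_inj; apply: contrapT => /flt_total[] /h_lt; rewrite hij ltnn //.
- rewrite !h_ltE; congr asbool; apply/propext.
  apply: (flt_conj (magnus_src_tgt i u0)); rewrite eqx; exact: magnus_src_tgt.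
Qed.

End Stacking.

(** Euclid's algorithm on the lengths: the shorter word is a prefix of the longer one and commutes
    with the rest of it. *)
Lemma cat_comm_power (T : eqType) (p q : seq T) : p != [::] -> q != [::] ->
  p ++ q = q ++ p -> exists v i j,
    [/\ 0 < i, 0 < j, p = flatten (nseq i v) & q = flatten (nseq j v)].
Proof.
have [m] := ubnP (size p + size q); elim: m p q => // m IHm p q.
wlog le_pq : p q / size p <= size q => [wl lt_m p0 q0 pq|].
  case: (leqP (size p) (size q)) => [|/ltnW] le_pq; first exact: wl.
  by case: (wl q p) => // [|v [i [j []]]]; [rewrite addnC | exists v, j, i].
move=> lt_m p0 q0 pq.
have eq_q : q = p ++ drop (size p) q.
  have := congr1 (take (size p)) pq; rewrite take_size_cat // takel_cat // => {1}->.
  by rewrite cat_take_drop.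
case: (eqVneq (drop (size p) q) [::]) => [d0|d0].
  by exists p, 1, 1; rewrite /= cats0; split; rewrite // eq_q d0 cats0.
have [||v [i [j [i0 j0 ep ed]]]] := IHm p (drop (size p) q) _ p0 d0.
- by move: p0; rewrite size_drop -size_eq0; lia.
- apply/eqP; have /eqP := pq; rewrite {1 2}eq_q -!catA eqseq_cat // eqxx /= => /eqP.
  by move=> ->.
exists v, i, (i + j); split=> //; first by rewrite addn_gt0 i0.
by rewrite eq_q nseqD flatten_cat -ep -ed.
Qed.

(** * Cocycles on a free group *)

Local Open Scope group_scope.

Definition morph_of (G H : groupType) (f : G -> H) (fM : {morph f : x y / x * y}) :
    {multiplicative G -> H} :=
  HB.pack f (isMultiplicative.Build G H f fM).

Section MorphTheory.

Variables (G H : groupType) (f : {multiplicative G -> H}).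

Lemma morphg1 : f 1 = 1.
Proof. by apply: (mulgI (f 1)); rewrite -gmulfM !mulg1. Qed.

Lemma morphgX k : {morph f : x / x ^+ k}.
Proof. by move=> x; elim: k => [|k IHk]; rewrite ?morphg1 // !expgS gmulfM IHk. Qed.

Lemma morphgV : {morph f : x / x^-1}.
Proof. by move=> x; apply: (mulgI (f x)); rewrite -gmulfM !mulgV morphg1. Qed.

Lemma morphgF : {morph f : x y / x / y}.
Proof. by move=> x y; rewrite gmulfM morphgV. Qed.

End MorphTheory.

Lemma free_basis_ext (G H : groupType) (B : G -> Prop) (f g : {multiplicative G -> H}) :
  free_basis B -> (forall b, B b -> f b = g b) -> f =1 g.
Proof. by move=> freeB eq_fg x; have [phi _ uphi] := freeB H g; rewrite (uphi f) // (uphi g). Qed.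

Lemma free_basis_conj (G : groupType) (B : G -> Prop) (g : G) :
  free_basis B -> free_basis (fun x => B (x ^ g)).
Proof.
have conjM y : {morph (fun x : G => x ^ y) : a b / a * b} by move=> a b; rewrite conjMg.
move=> freeB H f; have [phi ephi uphi] := freeB H (fun b => f (b ^ g^-1)).
exists (phi \o morph_of (conjM g) : {multiplicative G -> H}) => [b /= Bb|psi epsi x /=].
  by rewrite ephi // conjgK.
rewrite -(uphi (psi \o morph_of (conjM g^-1) : {multiplicative G -> H})) /= ?conjgK // => b Bb.
by rewrite /= epsi ?conjgKV.
Qed.

(* Morphisms from [G] to the wreath product that lift the identity of [G] are cocycles, so
   the universal property of a free group provides cocycles with given values on a basis. *)
Definition wreath (G H : groupType) : Type := ((G -> H) * G)%type.

Section Wreath.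

Variables G H : groupType.
Implicit Types p q : wreath G H.

Definition wreath_mul p q : wreath G H := (fun a => p.1 a * q.1 (a * p.2), p.2 * q.2).
Definition wreath_one : wreath G H := (fun=> 1, 1).
Definition wreath_inv p : wreath G H := (fun a => (p.1 (a / p.2))^-1, p.2^-1).

Lemma wreath_mulA : associative wreath_mul.
Proof. by move=> p q r; congr (_, _); rewrite ?mulgA //; apply/funext=> a /=; rewrite !mulgA. Qed.

Lemma wreath_mul1 : left_id wreath_one wreath_mul.
Proof. by case=> c g; congr (_, _); [apply/funext=> a|]; rewrite /= ?mulg1 mul1g. Qed.

Lemma wreath_mulr1 : right_id wreath_one wreath_mul.
Proof. by case=> c g; congr (_, _); [apply/funext=> a|]; rewrite /= mulg1. Qed.

Lemma wreath_mulV : left_inverse wreath_one wreath_inv wreath_mul.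
Proof. by case=> c g; congr (_, _); [apply/funext=> a|]; rewrite /= mulVg. Qed.

Lemma wreath_mulrV : right_inverse wreath_one wreath_inv wreath_mul.
Proof. by case=> c g; congr (_, _); [apply/funext=> a|]; rewrite /= ?mulgK mulgV. Qed.

HB.instance Definition _ := Choice.copy (wreath G H) ((G -> H) * G)%type.
HB.instance Definition _ := isGroup.Build (wreath G H)
  wreath_mulA wreath_mul1 wreath_mulr1 wreath_mulV wreath_mulrV.

End Wreath.

(** [C a g] is to be read as the product of edge labels along a path from [a] to [a * g] in the
    Cayley graph. *)
Definition cocycle (G H : groupType) (C : G -> G -> H) : Prop :=
  forall a g h, C a (g * h) = C a g * C (a * g) h.

Section Words.

Variables (F : groupType) (n : nat) (s : n.-tuple F).
Hypotheses (uniq_s : uniq s) (free_s : free_basis (fun x => x \in s)).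
Implicit Types (u v : seq ('I_n * bool)) (l : 'I_n * bool) (a g : F).

Definition lval l : F := if l.2 then tnth s l.1 else (tnth s l.1)^-1.

Definition eval u : F := foldr (fun l g => lval l * g) 1 u.

Lemma lval_opp l : lval (opp_letter l) = (lval l)^-1.
Proof. by case: l => i []; rewrite /lval /= ?invgK. Qed.

Lemma eval_cat u v : eval (u ++ v) = eval u * eval v.
Proof. by elim: u => /= [|l u ->]; rewrite ?mul1g ?mulgA. Qed.

Lemma eval_rcons u l : eval (rcons u l) = eval u * lval l.
Proof. by rewrite -cats1 eval_cat /= mulg1. Qed.

Lemma eval_inv_word u : eval (inv_word u) = (eval u)^-1.
Proof.
elim: u => [|l u IHu]; first by rewrite invg1.
by rewrite /inv_word /= rev_cons eval_rcons IHu lval_opp invgM.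
Qed.

Lemma cocycle_exists (H : groupType) (c : F -> 'I_n -> H) :
  exists2 C : F -> F -> H, cocycle C & forall a i, C a (tnth s i) = c a i.
Proof.
have [phi ephi _] := free_s (H := wreath F H)
  (fun b => (fun a => if [pick i | tnth s i == b] is Some i then c a i else 1, b)).
have [phi0 _ id_uniq] := free_s (H := F) id.
have phi2 : snd \o phi =1 id.
  move=> g; have phi2M : {morph snd \o phi : x y / x * y} by move=> x y; rewrite /= gmulfM.
  rewrite (id_uniq (morph_of phi2M)) => [|b sb]; last by rewrite /= ephi.
  by rewrite -(id_uniq idfun).
exists (fun a g => (phi g).1 a) => [a g h|a i].
  by rewrite gmulfM /=; congr (_ * (phi h).1 (a * _)); apply: phi2.
rewrite ephi ?mem_tnth //=; case: pickP => [j /eqP|/(_ i)]; last by rewrite eqxx.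
by move/(tuple_uniqP s uniq_s) ->.
Qed.

Lemma cocycle_uniq (H : groupType) (C C' : F -> F -> H) :
    cocycle C -> cocycle C' -> (forall a i, C a (tnth s i) = C' a (tnth s i)) ->
  forall a g, C a g = C' a g.
Proof.
move=> CM CM' eqC a g.
pose phi (D : F -> F -> H) x : wreath F H := (D^~ x, x).
have phiM D : cocycle D -> {morph phi D : x y / x * y}.
  by move=> DM x y; congr (_, _); apply/funext=> b /=; rewrite DM.
suff /(_ g)/(congr1 (fun p : wreath F H => p.1 a)) :
  morph_of (phiM _ CM) =1 morph_of (phiM _ CM') by [].
apply: (free_basis_ext free_s) => _ /tnthP[i ->].
by congr (_, _); apply/funext=> b /=.
Qed.

(* The coboundary of the indicator function of the subgroup generated by [s] vanishes on
   [s], hence everywhere. *)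
Lemma eval_surj g : exists u, eval u = g.
Proof.
pose chi a : 'I_2 := if `[<exists u, eval u = a>] then 1 else Zp1.
have chiM a i : chi (a * tnth s i) = chi a.
  rewrite /chi; congr (if _ then _ else _); apply/asbool_equiv_eq; split=> -[u eu].
    by exists (rcons u (i, false)); rewrite eval_rcons eu mulgK.
  by exists (rcons u (i, true)); rewrite eval_rcons eu.
pose C a h := (chi a)^-1 * chi (a * h).
have CM : cocycle C by move=> a h k; rewrite /C !mulgA mulgK.
have : C 1 g = 1.
  apply: (cocycle_uniq CM (C' := fun _ _ => 1)) => [a h k|a i]; first by rewrite mulg1.
  by rewrite /C chiM mulVg.
rewrite /C mul1g /chi asboolT; last by exists [::].
by rewrite invg1 mul1g; case: asboolP.
Qed.

(* The edge [(a, i)] goes from [a] to [a * tnth s i]; a negative letter read at [a]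
   follows backwards the edge that ends at [a]. *)
Definition step (H : groupType) (c : F -> 'I_n -> H) a l : H :=
  if l.2 then c a l.1 else (c (a * lval l) l.1)^-1.

Fixpoint pathc (H : groupType) (c : F -> 'I_n -> H) a u : H :=
  if u is l :: v then step c a l * pathc c (a * lval l) v else 1.

Lemma pathc_cat (H : groupType) (c : F -> 'I_n -> H) a u v :
  pathc c a (u ++ v) = pathc c a u * pathc c (a * eval u) v.
Proof.
by elim: u a => [|l u IHu] a /=; rewrite ?mul1g ?mulg1 // IHu !mulgA.
Qed.

Lemma cocycle1 (H : groupType) (C : F -> F -> H) a : cocycle C -> C a 1 = 1.
Proof. by move/(_ a 1 1); rewrite !mulg1 => /esym/(canRL (mulKg _)) ->; rewrite mulVg. Qed.

Lemma cocycleV (H : groupType) (C : F -> F -> H) a g : cocycle C -> C a g^-1 = (C (a / g) g)^-1.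
Proof.
move=> CM; have := CM (a / g) g g^-1; rewrite mulgV cocycle1 // mulgVK => /esym/eqP.
by rewrite mulg_eq1 => /eqP->; rewrite invgK.
Qed.

Lemma cocycle_lval (H : groupType) (C : F -> F -> H) a l : cocycle C ->
  C a (lval l) = if l.2 then C a (tnth s l.1) else (C (a * lval l) (tnth s l.1))^-1.
Proof. by move=> CM; case: l => i [] //=; rewrite /lval /= -cocycleV. Qed.

Lemma pathcE (H : groupType) (C : F -> F -> H) a u :
  cocycle C -> pathc (fun b i => C b (tnth s i)) a u = C a (eval u).
Proof.
move=> CM; elim: u a => [|[i b] u IHu] a /=; first by rewrite cocycle1.
rewrite CM IHu; congr (_ * _); rewrite /step /lval /=.
by case: b => //=; rewrite -cocycleV.
Qed.

End Words.

Lemma not_reduced (X : finType) (u : seq (X * bool)) :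
  ~~ reduced u -> exists a l b, u = a ++ [:: l, opp_letter l & b].
Proof.
elim: u => // l [|k u] //= IHu; rewrite /reduced /= negb_and negbK.
case/orP => [/eqP->|/IHu[a [l' [b ->]]]]; first by exists [::], l, u.
by exists (l :: a), l', b.
Qed.

Lemma letter_rot (X : finType) (l0 : X * bool) u i t :
  i <= size u -> letter l0 (rot i u) t = letter l0 u (t + i).
Proof.
case: (posnP (size u)) => [|u0 le_iu].
  by case: u => // _; rewrite /letter !nth_nil.
rewrite /letter size_rot -modnDml; move: (ltn_pmod t u0); set r := t %% _ => ltr.
rewrite /rot nth_cat size_drop nth_drop ltn_subRL addnC; case: ltnP => [lt_u|le_u].
  by rewrite modn_small.
rewrite nth_take; last by lia.
have -> : (r + i = (r + i - size u) + size u)%N by lia.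
by rewrite modnDr modn_small; [congr nth; lia | lia].
Qed.

(** * A basis in which a given element is a cyclically reduced word *)

Section Minimal.

Variables (F : groupType) (n : nat) (w : F).

Definition presents (s : n.-tuple F) (u : seq ('I_n * bool)) : Prop :=
  [/\ uniq s, free_basis (fun x => x \in s) & eval s u = w].

(** Rotating the word conjugates its value; conjugating the basis compensates for this. *)
Lemma presents_rot s u i :
  presents s u -> exists s', presents s' (rot i u).
Proof.
case=> uniq_s free_s eu; pose g := (eval s (take i u))^-1.
pose s' := [tuple of [seq x ^ g | x <- s]].
have eval_s' v : eval s' v = eval s v ^ g.
  elim: v => [|[j b] v /= ->]; first by rewrite conj1g.
  rewrite conjMg; congr (_ * _); rewrite /lval /= tnth_map.
  by case: b; rewrite // conjVg.
exists s'; split.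
- by rewrite map_inj_uniq //; apply: conjg_inj.
- suff -> : (fun x => x \in s' : Prop) = (fun x => x ^ g^-1 \in s) :> (F -> Prop).
    exact: (free_basis_conj g^-1 free_s).
  apply/funext=> x; congr is_true; apply/mapP/idP => [[y sy ->]|sx].
    by rewrite conjgK.
  by exists (x ^ g^-1); rewrite ?conjgKV.
- by rewrite eval_s' eval_cat -eu -[in RHS](cat_take_drop i u) eval_cat /g conjgE invgK mulgK.
Qed.

(** Take a shortest word for [w] over all bases of size [n]. A rotation that is not reduced could be
    shortened, and two equal rotations would make [w] a proper power. *)
Lemma cyclically_reduced_basis : w <> 1 -> ~ proper_power w -> free_of_rank F n ->
  exists s u, [/\ presents s u, u != [::], forall i, reduced (rot i u) &
    forall i j, i < size u -> j < size u -> rot i u = rot j u -> i = j].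
Proof.
move=> w1 npw [s0 uniq0 free0].
have [m [s [u su <-]] min_u] : exists2 m, (exists s, exists2 u, presents s u & size u = m)
    & forall m', (exists s, exists2 u, presents s u & size u = m') -> m <= m'.
  apply: ex_min_nat; have [u eu] := eval_surj free0 w.
  by exists (size u), s0, u.
exists s, u; split=> //.
- by apply/eqP=> u0; case: su => _ _; rewrite u0 => /esym.
- move=> i; apply: contrapT => /negP/not_reduced[a [l [b eab]]].
  have [s' [uniq_s' free_s' es']] := presents_rot i su.
  have : size u <= size (a ++ b).
    apply: min_u; exists s', (a ++ b) => //; split=> //.
    by rewrite -es' eab !eval_cat /= lval_opp mulVKg.
  by rewrite -(size_rot i u) eab !size_cat /=; lia.
- move=> i j; wlog lt_ij : i j / i <= j => [wl|] lt_i lt_j eq_rot.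
    by case/orP: (leq_total i j) => le_ij; [|symmetry]; apply: wl.
  case: (ltngtP i j) lt_ij => // lt_ij _; case: npw.
  have eq_ij : rot (j - i) (rot i u) = rot i u.
    by rewrite -rotD ?subnK ?eq_rot // ltnW.
  have [s' [uniq_s' free_s' es']] := presents_rot i su.
  move: eq_ij es' ; move: (rot i u) (size_rot i u) => v sv eqv es'.
  have [|||v' [a [b [a0 b0 ea eb]]]] := cat_comm_power (p := take (j - i) v) (q := drop (j - i) v).
  - by rewrite -size_eq0 size_take sv; case: ifP => _; lia.
  - by rewrite -size_eq0 size_drop sv; lia.
  - by rewrite cat_take_drop -[LHS]eqv.
  exists (eval s' v'), (a + b)%N; split; first by lia.
  have eval_flat k : eval s' (flatten (nseq k v')) = eval s' v' ^+ k.
    by elim: k => //= k IHk; rewrite eval_cat IHk expgS.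
  by rewrite -es' -(cat_take_drop (j - i) v) eval_cat ea eb !eval_flat expgnDr.
Qed.

Lemma stacked_basis (l0 : 'I_n * bool) :
    w <> 1 -> ~ proper_power w -> free_of_rank F n ->
  exists s u (h : nat -> nat), [/\ presents s u, u != [::],
    forall i, letter l0 u i.+1 <> opp_letter (letter l0 u i),
    forall i, h i <= h 0 &
    [/\ forall i, h (i %% size u) = h i,
        forall i j, h i = h j -> i = j %[mod size u] &
        forall i j, (letter l0 u i).1 = (letter l0 u j).1 ->
          (h (src l0 u i) < h (src l0 u j)) = (h (tgt l0 u i) < h (tgt l0 u j))]].
Proof.
move=> w1 npw freeF; have [s [u [su u0 red_u rot_u]]] := cyclically_reduced_basis w1 npw freeF.
have [h [hm hinj hc]] := stacking l0 red_u rot_u u0.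
have L0 : 0 < size u by rewrite lt0n size_eq0.
(* Rotating by [k] moves the highest position to [0]. *)
have [k _ max_k] := @arg_maxnP _ (Ordinal L0) xpredT h isT.
have le_k := ltnW (ltn_ord k).
have eq_letter t := letter_rot l0 t le_k.
have [s' su'] := presents_rot k su.
exists s', (rot k u), (fun i => h (i + k)%N); split=> //.
- by rewrite -size_eq0 size_rot size_eq0.
- move=> i; rewrite !eq_letter addSn; move: (i + k)%N => {}i.
  have [v ei ei1] := rot_letter l0 i u0; have := red_u (i %% size u); rewrite ei.
  have [v' ei' _] := rot_letter l0 i.+1 u0; rewrite ei1 in ei'.
  (* In a word of length one the next letter is the same one, and no letter is its own opposite. *)
  case: v ei ei1 ei' => [|l v] _ _; first by case=> <- _ _; case: (letter _ _ _) => x []; case.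
  by case=> -> _ /andP[/eqP].
- by move=> i; rewrite -hm; apply: (max_k (Ordinal (ltn_pmod (i + k) L0))).
- rewrite size_rot; split=> [i|i j /hinj/eqP|i j].
  + by rewrite -hm modnDml hm.
  + by rewrite eqn_modDr => /eqP.
  + rewrite !eq_letter => /hc; rewrite /src /tgt !eq_letter.
    by rewrite !(addnAC _ k).
Qed.

End Minimal.

(** * Coverings of the rose *)

Section Cosets.

Variables (F : groupType) (n : nat) (s : n.-tuple F).
Hypothesis free_s : free_basis (fun x => x \in s).
Variable Theta : {multiplicative F -> F}.

(* Equality of the vertices of the covering graph, i.e. of the right cosets of the image
   of [Theta]. *)
Definition coset_eq (a b : F) : Prop := exists g, a = Theta g * b.

Local Notation "a ~ b" := (coset_eq a b) (at level 70).

Lemma coset_eq_refl a : a ~ a.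
Proof. by exists 1; rewrite morphg1 mul1g. Qed.

Lemma coset_eq_sym a b : a ~ b -> b ~ a.
Proof. by case=> g ->; exists g^-1; rewrite mulgA -gmulfM mulVg morphg1 mul1g. Qed.

Lemma coset_eq_trans a b c : a ~ b -> b ~ c -> a ~ c.
Proof. by move=> [g ->] [h ->]; exists (g * h); rewrite gmulfM mulgA. Qed.

Lemma coset_eq_mulr a b x : a ~ b -> a * x ~ b * x.
Proof. by move=> [g ->]; exists g; rewrite mulgA. Qed.

Lemma cocycle_inv (H : groupType) (C : F -> F -> H) : cocycle C ->
    (forall g a i, C (Theta g * a) (tnth s i) = C a (tnth s i)) ->
  forall g a x, C (Theta g * a) x = C a x.
Proof.
move=> CM Cinv g; apply: (cocycle_uniq free_s) => //.
by move=> a x y; rewrite CM mulgA.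
Qed.

(** An invariant cocycle lives on the covering graph; on closed paths at the base point it is a
    morphism of the fundamental group. *)
Lemma cocycle_hom (H : groupType) (C : F -> F -> H) : cocycle C ->
    (forall g a x, C (Theta g * a) x = C a x) ->
  {morph (fun g => C 1 (Theta g)) : x y / x * y}.
Proof. by move=> CM Cinv x y; rewrite gmulfM CM mul1g -{2}[Theta x]mulg1 Cinv. Qed.

End Cosets.

(** * A Schreier basis adapted to an edge crossed once *)

Section TraversedOnce.

Variables (F : groupType) (n : nat) (s : n.-tuple F).
Hypotheses (uniq_s : uniq s) (free_s : free_basis (fun x => x \in s)).
Variable Theta : {multiplicative F -> F}.
Hypothesis Theta_inj : injective Theta.
Variables (p q : seq ('I_n * bool)) (l : 'I_n * bool) (w : F).
Hypothesis Theta_w : Theta w = eval s (p ++ l :: q).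
Implicit Types (a b g : F) (k : 'I_n * bool) (u v : seq ('I_n * bool)).

Local Notation "a ~ b" := (coset_eq Theta a b) (at level 70).

(** The initial vertex, in the direction of the generator, of the edge that [k] crosses from [a]. *)
Definition start a k : F := if k.2 then a else a * lval s k.

Let e := start (eval s p) l.

Definition on a (i : 'I_n) : Prop := i = l.1 /\ a ~ e.

Fixpoint avoids a u : Prop :=
  if u is k :: v then ~ on (start a k) k.1 /\ avoids (a * lval s k) v else True.

Let p' := eval s p * lval s l.

Hypotheses (avoids_p : avoids 1 p) (avoids_q : avoids p' q).

Lemma on_eqK a b i : a ~ b -> on a i -> on b i.
Proof. by move=> ab [-> ae]; split=> //; apply: coset_eq_trans ae; apply: coset_eq_sym. Qed.

Lemma start_eqK a b k : a ~ b -> start a k ~ start b k.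
Proof. by rewrite /start; case: k.2 => // /coset_eq_mulr. Qed.

Lemma avoids_eqK a b u : a ~ b -> avoids a u -> avoids b u.
Proof.
elim: u a b => //= k u IHu a b ab [nk av]; split; last exact: IHu (coset_eq_mulr _ ab) av.
by move=> nb; apply: nk; apply: on_eqK nb; apply/start_eqK/coset_eq_sym.
Qed.

Lemma avoids_cat a u v : avoids a (u ++ v) <-> avoids a u /\ avoids (a * eval s u) v.
Proof.
elim: u a => [|k u IHu] a /=; first by rewrite mulg1; tauto.
by rewrite IHu mulgA; tauto.
Qed.

Lemma avoids_rcons a u k :
  avoids a (rcons u k) <-> avoids a u /\ ~ on (start (a * eval s u) k) k.1.
Proof. by rewrite -cats1 avoids_cat /=; tauto. Qed.

Lemma start_opp a k : start (a * lval s k) (opp_letter k) = start a k.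
Proof. by case: k => i []; rewrite /start /= ?lval_opp ?mulgK. Qed.

Lemma avoids_inv a u : avoids a u -> avoids (a * eval s u) (inv_word u).
Proof.
elim: u a => [|k u IHu] a //= [nk /IHu av]; rewrite /inv_word /= rev_cons avoids_rcons.
rewrite mulgA; split=> //.
by rewrite eval_inv_word mulgK start_opp.
Qed.

(** Removing the edge leaves the graph connected: one end is reached along [p], the other backwards
    along [q], as the whole path is closed. *)
Lemma reach g : exists u, avoids 1 u /\ eval s u ~ g.
Proof.
pose R a := exists u, avoids 1 u /\ eval s u ~ a.
have R_eqK a b : a ~ b -> R a -> R b.
  by move=> ab [u [av ua]]; exists u; split=> //; apply: coset_eq_trans ab.
have Rp : R (eval s p) by exists p; split=> //; apply: coset_eq_refl.
have Rp' : R p'.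
  have epq : p' * eval s q = Theta w by rewrite Theta_w eval_cat /= mulgA.
  exists (inv_word q); split.
    apply: avoids_eqK (avoids_inv avoids_q); rewrite epq.
    by exists w; rewrite mulg1.
  apply: coset_eq_sym; exists w; rewrite eval_inv_word -epq mulgK //.
have Rk a k : R a -> R (a * lval s k).
  move=> Ra; case: (pselect (on (start a k) k.1)) => [[ei ae]|nk]; last first.
    have [u [av ua]] := Ra; exists (rcons u k); split; last by rewrite eval_rcons; apply: coset_eq_mulr.
    rewrite avoids_rcons mul1g; split=> // nu; apply: nk; apply: on_eqK nu; exact: start_eqK.
  have Re : R e by rewrite /e /start; case: l.2.
  have Re' : R (e * tnth s l.1).
    by move: Rp Rp'; rewrite /e /p' /start /lval; case: l.2; rewrite ?mulgVK.
  case: k ei ae => i [] /= ei; rewrite /start /= => ae; last exact: R_eqK (coset_eq_sym ae) Re.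
  by rewrite /lval /= ei; apply: R_eqK Re'; apply/coset_eq_mulr/coset_eq_sym.
have [u <-] := eval_surj free_s g.
elim/last_ind: u => [|u k IHu]; last by rewrite eval_rcons; apply: Rk.
by exists [::]; split=> //; apply: coset_eq_refl.
Qed.

(* The words [tau g] are the branches at [1] of a spanning tree that omits the edge [e]. *)
Let least g u := [/\ avoids 1 u, eval s u ~ g &
  forall v, avoids 1 v -> eval s v ~ g -> code u <= code v].

Lemma least_exists g : exists u, least g u.
Proof.
have [m [u [av ug] <-] min_u] : exists2 m, (exists2 u, avoids 1 u /\ eval s u ~ g & code u = m)
    & forall m', (exists2 u, avoids 1 u /\ eval s u ~ g & code u = m') -> m <= m'.
  by apply: ex_min_nat; have [u ug] := reach g; exists (code u), u.
by exists u; split=> // v av_v vg; apply: min_u; exists v.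
Qed.

Let tau g := sval (cid (least_exists g)).

Let tauP g : least g (tau g).
Proof. by rewrite /tau; case: cid. Qed.

Let tau_uniq g u : least g u -> tau g = u.
Proof.
have [av ug min_t] := tauP g; case=> av_u ug' min_u; apply: code_inj.
by apply/eqP; rewrite eqn_leq min_t //= min_u.
Qed.

Let tau_eqK a b : a ~ b -> tau a = tau b.
Proof.
move=> ab; apply: tau_uniq; have [av ub min_t] := tauP b; split=> //.
  by apply: coset_eq_trans ub _; apply: coset_eq_sym.
by move=> v av_v va; apply: min_t => //; apply: coset_eq_trans ab.
Qed.

(** Appending a letter preserves the order of codes, so a prefix of a least word is least; hence the
    branches form a tree. *)
Let tau_rcons g u k : tau g = rcons u k -> tau (eval s u) = u.
Proof.
move=> eg; apply: tau_uniq; have [av ug min_t] := tauP g; move: av ug min_t; rewrite {}eg.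
rewrite avoids_rcons mul1g eval_rcons => -[av nk] ug min_t; split=> [//||v av_v vu].
  exact: coset_eq_refl.
rewrite leqNgt; apply/negP=> /(ltn_code_rcons k); rewrite ltnNge min_t //.
  rewrite avoids_rcons mul1g; split=> // nv; apply: nk.
  by apply: on_eqK nv; apply: start_eqK.
by rewrite eval_rcons; apply: coset_eq_trans ug; apply: coset_eq_mulr.
Qed.

Let r g := eval s (tau g).

Let r_eqK g : r g ~ g.
Proof. by have [] := tauP g. Qed.

Let r_inv a b : a ~ b -> r a = r b.
Proof. by rewrite /r => /tau_eqK->. Qed.

Let r1 : r 1 = 1.
Proof. by rewrite /r (@tau_uniq 1 [::]) //; split=> //; apply: coset_eq_refl. Qed.

Lemma return_exists a g : exists b, Theta b = r a * g / r (a * g).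
Proof.
have [b eb] := r_eqK a; have [c ec] := r_eqK (a * g); exists (b / c).
by rewrite morphgF eb ec -[_ * a * g]mulgA mulgKA.
Qed.

Let z a g := sval (cid (return_exists a g)).

Let zE a g : Theta (z a g) = r a * g / r (a * g).
Proof. by rewrite /z; case: cid. Qed.

Let z_cocycle : cocycle z.
Proof.
by move=> a g h; apply: Theta_inj; rewrite gmulfM !zE !mulgA mulgVK.
Qed.

Let z_inv a b g : a ~ b -> z a g = z b g.
Proof. by move=> ab; apply: Theta_inj; rewrite !zE (r_inv ab) (r_inv (coset_eq_mulr g ab)). Qed.

Let z_Theta g : z 1 (Theta g) = g.
Proof.
apply: Theta_inj; rewrite zE mul1g r1 mul1g (@r_inv _ 1) ?r1 ?invg1 ?mulg1 //.
by exists g; rewrite mulg1.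
Qed.

(** Both ends of a tree edge are their own representatives, so its Schreier generator is trivial. *)
Let tau_step g u k : tau g = rcons u k ->
  z (start (eval s u) k) (tnth s k.1) = 1.
Proof.
move=> eg; have eu : r (eval s u) = eval s u by rewrite /r (tau_rcons eg).
have eg' : r (eval s u * lval s k) = eval s u * lval s k.
  by rewrite -eval_rcons -eg -[eval s (tau g)]/(r g) (r_inv (r_eqK g)).
apply: Theta_inj; rewrite zE morphg1; move: eg'.
case: k {eg} => i [] /=; rewrite /start /lval /= => eg'.
  by rewrite eu eg' mulgV.
by rewrite eg' mulgVK eu mulgV.
Qed.

Let pathc_avoids (H : groupType) (c c' : F -> 'I_n -> H) a u :
  (forall b i, ~ on b i -> c b i = c' b i) -> avoids a u -> pathc s c a u = pathc s c' a u.
Proof.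
move=> eqc; elim: u a => //= k u IHu a [nk /IHu->]; congr (_ * _).
by move: nk; rewrite /step /start; case: k.2 => /eqc->.
Qed.

(* [z a (tnth s i)] is the Schreier generator of the edge [(a, i)]; that of the edge [e] is
   replaced by [w], whose path crosses [e] once. *)
Definition cut_basis b : Prop :=
  b = w \/ b <> 1 /\ exists a i, ~ on a i /\ b = z a (tnth s i).

(** The associated cocycles agree off the edge [e]. Cancelling the values along [p] and [q] from the
    value at [w] gives agreement on [e] too. *)
Lemma morph_unique (H : groupType) (f g : {multiplicative F -> H}) :
  (forall b, cut_basis b -> f b = g b) -> f =1 g.
Proof.
move=> eq_fg.
pose C (f0 : {multiplicative F -> H}) a x := f0 (z a x).
have CM f0 : cocycle (C f0) by move=> a x y; rewrite /C z_cocycle gmulfM.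
have eq_off a i : ~ on a i -> C f a (tnth s i) = C g a (tnth s i).
  move=> noi; rewrite /C; case: (eqVneq (z a (tnth s i)) 1) => [->|/eqP nz].
    by rewrite !morphg1.
  by apply: eq_fg; right; split=> //; exists a, i.
have eq_e : C f e (tnth s l.1) = C g e (tnth s l.1).
  have : C f 1 (Theta w) = C g 1 (Theta w) by rewrite /C z_Theta; apply: eq_fg; left.
  rewrite Theta_w -!pathcE // !pathc_cat /= !mul1g.
  rewrite (pathc_avoids eq_off avoids_p) => /mulgI.
  rewrite (pathc_avoids eq_off avoids_q) => /mulIg.
  by rewrite /step /e /start; case: l.2 => // /invg_inj.
move=> x; rewrite -[x]z_Theta; apply: (cocycle_uniq free_s (CM f) (CM g)) => a i.
case: (pselect (on a i)) => [[-> ae]|]; last exact: eq_off.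
by move: eq_e; rewrite /C !(z_inv _ ae).
Qed.

Lemma cut_basis_free : free_basis cut_basis.
Proof.
move=> H f.
pose c x a i : H := if `[<on a i>] then x else
  if z a (tnth s i) == 1 then 1 else f (z a (tnth s i)).
(* Solving for the contribution of [l] that gives the path of [w] the value [f w]. The label [1] put
   on [e] is a placeholder, since [p] and [q] avoid [e]. *)
pose x := (pathc s (c 1) 1 p)^-1 * f w / pathc s (c 1) p' q.
pose c0 := c (if l.2 then x else x^-1).
have [C CM eqC] := cocycle_exists uniq_s free_s c0.
have C_inv g a y : C (Theta g * a) y = C a y.
  apply: (cocycle_inv free_s) => // {}g {}a i; rewrite !eqC /c0 /c.
  have ga : Theta g * a ~ a by exists g.
  rewrite (z_inv _ ga); congr (if _ then _ else _).
  by apply/asbool_equiv_eq; split; apply: on_eqK => //; apply: coset_eq_sym.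
have pathE a u : pathc s c0 a u = C a (eval s u).
  by rewrite -pathcE //; congr pathc; apply/funext=> b; apply/funext=> i.
have C_off y b i : ~ on b i -> c0 b i = c y b i by move=> nb; rewrite /c0 /c !asboolF.
have C_tau g : C 1 (r g) = 1.
  rewrite /r; move: {-1}(tau g) (erefl (tau g)) => u; elim/last_ind: u g => [|u k IHu] g eu.
    by rewrite cocycle1.
  rewrite eval_rcons CM mul1g (IHu _ (tau_rcons eu)) mul1g.
  have nk : ~ on (start (eval s u) k) k.1.
    by have [+ _ _] := tauP g; rewrite eu avoids_rcons mul1g => -[].
  have := tau_step eu; have := eqC (start (eval s u) k) k.1.
  rewrite /c0 /c asboolF // => + z1; rewrite z1 eqxx /start (cocycle_lval s _ _ CM).
  by case: k.2 => // ->; rewrite invg1.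
have phiM := cocycle_hom CM C_inv.
have phi_B b : cut_basis b -> morph_of phiM b = f b.
  case=> [->|[nb [a [i [noi eb]]]]] /=.
- rewrite Theta_w -pathE pathc_cat /= mul1g.
  rewrite (pathc_avoids (C_off 1) avoids_p) (pathc_avoids (C_off 1) avoids_q).
  have -> : step s c0 (eval s p) l = x.
    have one : on e l.1 by split=> //; apply: coset_eq_refl.
    move: one; rewrite /step /c0 /c /e /start.
    by case: l.2 => one; rewrite asboolT // invgK.
  by rewrite /x !mulgA mulgV mul1g mulgVK.
(* The closed path goes out along a branch, crosses one edge and returns along a branch; by [C_tau]
   only the edge contributes. *)
- have ez : Theta b = r a * tnth s i / r (a * tnth s i) by rewrite eb zE.
  rewrite ez !CM !mul1g C_tau mul1g cocycleV // -ez -[Theta b]mulg1 C_inv C_tau invg1 mulg1.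
  have [g ->] := r_eqK a; rewrite C_inv eqC /c0 /c asboolF // -eb.
  by case: eqP nb.
exists (morph_of phiM) => // psi epsi.
by apply: morph_unique => b Bb; rewrite epsi // phi_B.
Qed.

Lemma traversed_once_primitive : primitive w.
Proof. by exists cut_basis; [apply: cut_basis_free | left]. Qed.

End TraversedOnce.

(** * Counting the edges seen from above *)

Section Cover.

Variables (F : groupType) (n : nat) (s : n.-tuple F).
Hypotheses (uniq_s : uniq s) (free_s : free_basis (fun x => x \in s)).
Variable Theta : {multiplicative F -> F}.

Local Notation "a ~ b" := (coset_eq Theta a b) (at level 70).

Variables (l0 : 'I_n * bool) (u : seq ('I_n * bool)) (h : nat -> nat) (N : nat).

Let w := eval s u.
Let L := size u.
Let T := (N * L)%N.
Let lt := letter l0 u.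
Let source := src l0 u.
Let target := tgt l0 u.

Hypotheses (u_neq0 : u != [::]) (N_gt0 : 0 < N).
Hypothesis npw : ~ proper_power w.
Hypothesis Theta_inj : injective Theta.
Hypothesis Theta_w : Theta w = w ^+ N.
Hypothesis cyc_red : forall i, lt i.+1 <> opp_letter (lt i).
Hypothesis h_max : forall i, h i <= h 0.
Hypothesis h_mod : forall i, h (i %% L) = h i.
Hypothesis h_inj : forall i j, h i = h j -> i = j %[mod L].
Hypothesis h_compat : forall i j, (lt i).1 = (lt j).1 ->
  (h (source i) < h (source j)) = (h (target i) < h (target j)).

Let L_gt0 : 0 < L. Proof. by rewrite lt0n size_eq0. Qed.
Let T_gt0 : 0 < T. Proof. by rewrite muln_gt0 N_gt0. Qed.

(** The point reached after [t] letters of the periodic word [u u u ...]; in the covering graph it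
    has period [T]. *)
Definition vertex (t : nat) : F := w ^+ (t %/ L) * eval s (take (t %% L) u).

Lemma vertex0 : vertex 0 = 1.
Proof. by rewrite /vertex div0n mod0n take0 mulg1. Qed.

Lemma vertex_mulD j t : vertex (j * L + t) = w ^+ j * vertex t.
Proof. by rewrite /vertex divnMDl // modnMDl expgnDr mulgA. Qed.

Lemma vertex_small r : r < L -> vertex r = eval s (take r u).
Proof. by move=> ltr; rewrite /vertex divn_small // modn_small // mul1g. Qed.

Lemma vertexS t : vertex t.+1 = vertex t * lval s (lt t).
Proof.
rewrite {1 2}(divn_eq t L) -addnS !vertex_mulD -mulgA; congr (_ * _).
have lt_t := ltn_pmod t L_gt0; rewrite /lt /letter -/L (vertex_small lt_t).
rewrite -eval_rcons -take_nth //.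
case: (ltngtP (t %% L).+1 L) => [/vertex_small//|lt1|->].
  by move: lt1; rewrite ltnS leqNgt lt_t.
by rewrite take_size -[L]addn0 -[X in (X + _)%N]mul1n vertex_mulD vertex0 mulg1.
Qed.

Lemma vertex_target t : vertex (target t) = vertex (source t) * tnth s (lt t).1.
Proof.
rewrite /target /source /src /tgt -/(lt t); have := vertexS t; rewrite /lval.
by case: (lt t) => i [] /=; rewrite addn0 addn1 => ->; rewrite ?mulgVK.
Qed.

Lemma letter_mod t : lt (t %% T) = lt t.
Proof. by rewrite /lt /letter modn_dvdm // dvdn_mull. Qed.

Lemma vertex_mod t : vertex (t %% T) ~ vertex t.
Proof.
apply: coset_eq_sym; exists (w ^+ (t %/ T)).
by rewrite {1}(divn_eq t T) mulnA vertex_mulD morphgX Theta_w -expgnA mulnC.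
Qed.

(* With [m0 = gcdn m N], [w ^+ m0] is the image of some [g0], and [w] is the power of [g0]
   with exponent [N %/ m0]. *)
Lemma power_in_image g m : Theta g = w ^+ m -> N %| m.
Proof.
case: (posnP m) => [-> //|m_gt0 eg].
have [a b ab _] := egcdnP N m_gt0.
pose g0 := g ^+ a / w ^+ b.
have e0 : Theta g0 = w ^+ gcdn m N.
  rewrite morphgF !morphgX Theta_w eg -!expgnA mulnC ab (mulnC N) expgnDr.
  rewrite -expgnDr addnC expgnDr.
  by rewrite mulgK.
have /dvdnP[q eN] := dvdn_gcdr m N.
have ew : w = g0 ^+ q.
  by apply: Theta_inj; rewrite morphgX e0 Theta_w -expgnA mulnC -eN.
have q1 : q = 1%N.
  case: q eN ew => [|[|q]] //; first by rewrite mul0n => N0; move: N_gt0; rewrite N0.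
  by move=> _ ew; case: npw; exists g0, q.+2.
by rewrite eN q1 mul1n dvdn_gcdl.
Qed.

(** Equal heights give equal positions in [u], so the two points differ by a power of [w] in the
    image of [Theta]; by [power_in_image] its exponent is a multiple of [N]. *)
Lemma vertex_inj t t' : vertex t ~ vertex t' -> h t = h t' -> t = t' %[mod T].
Proof.
move=> eq_v /h_inj; wlog le_q : t t' eq_v / t' %/ L <= t %/ L => [wl|] eq_r.
  by case/orP: (leq_total (t' %/ L) (t %/ L)) => le_q; [|symmetry]; apply: wl => //; apply: coset_eq_sym.
have [g] := eq_v; rewrite /vertex eq_r mulgA => /mulIg.
rewrite -(subnK le_q) expgnDr => /mulIg/esym/power_in_image/dvdnP[q eq_q].
rewrite (divn_eq t L) -(subnK le_q) eq_q eq_r mulnDl -mulnA -addnA modnMDl.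
by rewrite -divn_eq.
Qed.

Definition same_edge (t t' : nat) : Prop :=
  (lt t).1 = (lt t').1 /\ vertex (source t) ~ vertex (source t').

Lemma same_edge_target t t' : same_edge t t' -> vertex (target t) ~ vertex (target t').
Proof. by case=> ei ev; rewrite !vertex_target ei; apply: coset_eq_mulr. Qed.

(** The two sources coincide on the curve by [vertex_inj]; crossing in opposite directions would
    then put a letter next to its opposite. *)
Lemma edge_inj t t' : same_edge t t' -> h (source t) = h (source t') -> t = t' %[mod T].
Proof.
case=> ei ev /(vertex_inj ev).
have no_opp k k' : k = k'.+1 %[mod T] -> (lt k).1 = (lt k').1 -> (lt k).2 <> ~~ (lt k').2.
  move=> ek e1 e2; apply: (@cyc_red k').
  by rewrite -letter_mod -ek letter_mod [lt k]surjective_pairing e1 e2.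
rewrite /source /src -/(lt t) -/(lt t').
case eb: (lt t).2; case eb': (lt t').2; rewrite /= ?addn0 ?addn1 // => et.
- by case: (no_opp t t'); rewrite ?eb ?eb'.
- by case: (no_opp t' t); rewrite ?eb ?eb'.
- by apply/eqP; rewrite -(eqn_modDr 1) !addn1 et.
Qed.

Lemma source_or_target (Q : nat -> Prop) t :
  Q t \/ Q t.+1 -> Q (source t) \/ Q (target t).
Proof. by rewrite /source /target /src /tgt; case: (_.2); rewrite /= addn0 addn1; tauto. Qed.

(** Visibility from above of a point of the lifted curve; [topE] is the analogue for edges. *)
Definition topV (t : nat) : Prop := forall k, vertex k ~ vertex t -> h k <= h t.

Definition topE (t : nat) : Prop :=
  forall k, same_edge k t -> h (source k) <= h (source t).

Lemma h_modT t : h (t %% T) = h t.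
Proof. by rewrite -h_mod modn_dvdm ?h_mod // dvdn_mull. Qed.

Lemma topV_mod t : topV (t %% T) <-> topV t.
Proof.
split=> top k ek.
  rewrite -(h_modT t); apply: top; apply: coset_eq_trans ek _; apply/coset_eq_sym/vertex_mod.
by rewrite h_modT; apply: top; apply: coset_eq_trans ek _; apply/vertex_mod.
Qed.

(** Strands over one edge keep their order from source to target by [h_compat], so one visible end
    suffices. *)
Lemma topV_topE t : topV t \/ topV t.+1 -> topE t.
Proof.
case/source_or_target => top k ek; first by apply: top; case: ek.
have := top _ (same_edge_target ek); rewrite leqNgt => /negP lt_t.
by rewrite leqNgt; apply/negP; case: ek => /esym/h_compat->.
Qed.

Lemma topV_exists t : exists k : 'I_T, topV k /\ vertex t ~ vertex k.
Proof.
have [m [k ek <-] min_m] : exists2 m, (exists2 k, vertex t ~ vertex k & h 0 - h k = m)%N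
   & forall m', (exists2 k, vertex t ~ vertex k & h 0 - h k = m')%N -> m <= m'.
  by apply: ex_min_nat; exists (h 0 - h t)%N, t => //; apply: coset_eq_refl.
exists (Ordinal (ltn_pmod k T_gt0)); split; last first.
  by apply: coset_eq_trans ek _; apply/coset_eq_sym/vertex_mod.
apply/topV_mod => k' ek'; have := min_m _ (ex_intro2 _ _ k' (coset_eq_trans ek (coset_eq_sym ek')) erefl).
by have := h_max k; have := h_max k'; lia.
Qed.

Definition tops : {set 'I_T} := [set t : 'I_T | `[<topV t>]].
Definition top_edges : {set 'I_T} := [set t : 'I_T | `[<topE t>]].

Section Twice.

Hypothesis twice : forall t, exists2 t', t' <> t %[mod T] & same_edge t' t.

(** A second strand over this edge is not below it at the lowest end, and by [edge_inj] not at equal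
    height either. *)
Lemma bottom_not_topE b : (forall k, h b <= h k) -> ~ topE b.
Proof.
move=> h_b top_b; have [t neq_t e_t] := twice b; case: neq_t; apply: edge_inj => //.
have := top_b _ e_t; case: e_t => ei _; have := h_compat ei; have := h_compat (esym ei).
have [||] := @source_or_target (fun k => forall t, h k <= h t) b; first by left.
  by move/(_ (source t)); lia.
by move/(_ (target t)); lia.
Qed.

(* The right-hand side minus [#|tops|] counts the arcs seen from above, by their last
   edges; [D] consists of those that end after a visible vertex. *)
Lemma leq_tops_top_edges : N + #|tops| <= #|top_edges|.
Proof.
pose D : {set 'I_T} := [set t : 'I_T | `[<topV t>] && ~~ `[<topV t.+1>]].
pose A : {set 'I_T} := [set t : 'I_T | `[<topV t.+1>]].
have cardA : #|A| = #|tops|.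
  have -> : A = @ordS T @^-1: tops.
    by apply/setP=> t; rewrite !inE; apply: (asbool_equiv_eq (iff_sym (topV_mod t.+1))).
  by rewrite on_card_preimset //; apply/onW_bij/ordS_bij.
have sub_E : D :|: A \subset top_edges.
  apply/subsetP=> t; rewrite !inE => tD; apply/asboolP/topV_topE.
  by case/orP: tD => [/andP[/asboolP tt _]|/asboolP tt]; [left|right].
have dis_DA : [disjoint D & A].
  rewrite -setI_eq0; apply/eqP/setP=> t; rewrite !inE.
  by rewrite -andbA andNb andbF.
apply: leq_trans (subset_leq_card sub_E); rewrite cardsU (disjoint_setI0 dis_DA) cards0 subn0.
rewrite cardA leq_add2r.
have [i0 _ min_i0] := @arg_minnP _ (Ordinal L_gt0) xpredT h isT.
have h_i0 k : h i0 <= h k by rewrite -(h_mod k); apply: (min_i0 (Ordinal (ltn_pmod k L_gt0))).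
(* In turn [j], visibility is lost somewhere between the highest point [j * L] and the lowest point
   [j * L + i0]. *)
have lap (j : 'I_N) : exists t : 'I_T, (t \in D) && (t %/ L == j).
  have h_jL r : h (j * L + r) = h r by rewrite -h_mod modnMDl h_mod.
  have top_jL : topV (j * L + 0) by move=> k _; rewrite h_jL.
  have ntop_i0 : ~ topV (j * L + i0).
    by move=> tt; apply: (@bottom_not_topE (j * L + i0)); [move=> k; rewrite h_jL | apply: topV_topE; left].
  have [r lt_r [tr ntr]] : exists2 r, r < i0 & topV (j * L + r) /\ ~ topV (j * L + r.+1).
    elim: (nat_of_ord i0) ntop_i0 => [/(_ top_jL)//|m IHm] ntop_m.
    case: (pselect (topV (j * L + m))) => [tm|/IHm[r ltr Pr]]; first by exists m.
    by exists r => //; apply: ltnW.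
  have lt_rL : r < L := ltn_trans lt_r (ltn_ord i0).
  have lt_T : j * L + r < T.
    have : j.+1 * L <= T by rewrite leq_pmul2r.
    by rewrite mulSn; lia.
  exists (Ordinal lt_T); rewrite inE /= divnMDl // divn_small // addn0 eqxx andbT.
  by rewrite asboolT //=; apply/asboolPn; rewrite -addnS.
pose f j := xchoose (lap j).
have fP j : (f j \in D) && (f j %/ L == j) by exact: (xchooseP (lap j)).
have f_inj : injective f.
  move=> j j' eq_f; apply/val_inj => /=.
  have /andP[_ /eqP ej] := fP j; have /andP[_ /eqP ej'] := fP j'.
  by rewrite -ej -ej' eq_f.
rewrite -{1}(card_ord N) -(card_imset _ f_inj); apply/subset_leq_card/subsetP.
by move=> _ /imsetP[j _ ->]; case/andP: (fP j).
Qed.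

End Twice.

Let chi (A : {set 'I_T}) (a : F) (i : 'I_n) : 'I_2 :=
  if `[<exists t : 'I_T, [/\ t \in A, a ~ vertex (source t) & (lt t).1 = i]>] then Zp1 else 1.

Lemma cochain_exists A : exists C : F -> F -> 'I_2,
  [/\ cocycle C, forall a i, C a (tnth s i) = chi A a i &
      forall g a x, C (Theta g * a) x = C a x].
Proof.
have [C CM eqC] := cocycle_exists uniq_s free_s (chi A).
exists C; split=> //; apply: cocycle_inv => // g a i; rewrite !eqC /chi.
congr (if _ then _ else _); apply/asbool_equiv_eq; split=> -[t [tA et ei]]; exists t; split=> //.
  by apply: coset_eq_trans et; apply: coset_eq_sym; exists g.
by apply: coset_eq_trans et; exists g.
Qed.

(* A cochain modulo 2 supported on the top edges is determined by the morphism it induces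
   on the image of [Theta] and by its values on paths to the top vertices. *)
Lemma leq_top_edges_rank : #|top_edges| < n + #|tops|.
Proof.
pose C A := sval (cid (cochain_exists A)).
have CP A : [/\ cocycle (C A), forall a i, C A a (tnth s i) = chi A a i &
    forall g a x, C A (Theta g * a) x = C A a x] by rewrite /C; case: cid.
pose o := Ordinal T_gt0.
have top_o : o \in tops by rewrite inE; apply/asboolP=> k _; apply: h_max.
(* Position [o] is the base point, where each cocycle is trivial; leaving it out makes the bound
   strict. *)
pose Phi A : {ffun 'I_n -> 'I_2} * {set 'I_T} :=
  ([ffun i => C A 1 (Theta (tnth s i))], [set t in tops :\ o | C A 1 (vertex t) != 1]).
have Phi_inj : {in powerset top_edges &, injective Phi}.
  move=> A B; rewrite !inE => sA sB [/ffunP eq_hom /setP eq_top].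
  have [CMA chiA invA] := CP A; have [CMB chiB invB] := CP B.
  have eq_Theta : forall g, C A 1 (Theta g) = C B 1 (Theta g).
    apply: (free_basis_ext (f := morph_of (cocycle_hom CMA invA))
             (g := morph_of (cocycle_hom CMB invB)) free_s) => _ /tnthP[i ->].
    by have := eq_hom i; rewrite !ffunE.
  have eq_tops (t : 'I_T) : topV t -> C A 1 (vertex t) = C B 1 (vertex t).
    move=> tt; case: (eqVneq t o) => [->|neq_to]; first by rewrite vertex0 !cocycle1.
    have := eq_top t; rewrite !inE neq_to asboolT //=.
    move: (C A 1 _) (C B 1 _) => x y; case: x y => [[|[|x]] ltx] [[|[|y]] lty] // _; exact/val_inj.
  (* Each vertex of the path lies in the coset of a visible one, so the values agree at all of them,
     hence on all edges of the path. *)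
  have eq_v t : C A 1 (vertex t) = C B 1 (vertex t).
    have [k [tk [g ->]]] := topV_exists t.
    by rewrite CMA CMB mul1g eq_Theta -[Theta g]mulg1 invA invB eq_tops.
  have eq_chi t : chi A (vertex (source t)) (lt t).1 = chi B (vertex (source t)) (lt t).1.
    have := eq_v t.+1; rewrite vertexS CMA CMB eq_v => /mulgI.
    rewrite !mul1g (cocycle_lval s _ _ CMA) (cocycle_lval s _ _ CMB) -vertexS !chiA !chiB /source /src -/(lt t).
    by case: (_.2); rewrite /= ?addn0 ?addn1 // => /invg_inj.
  (* Distinct members of [top_edges] lie over distinct edges, so the cochain determines the set. *)
  have chiE (A' : {set 'I_T}) (t : 'I_T) : A' \subset top_edges -> t \in top_edges ->
      (t \in A') = (chi A' (vertex (source t)) (lt t).1 != 1).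
    move=> sA' tE; rewrite /chi; case: asboolP => [[t' [t'A ev ei]]|no_t].
      suff -> : t = t' by rewrite t'A.
      have t'E := subsetP sA' _ t'A; rewrite inE in tE; rewrite inE in t'E.
      move/asboolP in tE; move/asboolP in t'E.
      have e_tt' : same_edge t t' by [].
      have e_t't : same_edge t' t by split; [|apply: coset_eq_sym].
      have := edge_inj e_tt'; rewrite !modn_small // => eq_t; apply/val_inj/eq_t.
      by apply/eqP; rewrite eqn_leq t'E // tE.
    rewrite eqxx; apply/negbTE/negP=> tA; apply: no_t; exists t; split=> //.
    exact: coset_eq_refl.
  apply/setP=> t; case: (boolP (t \in top_edges)) => [tE|ntE].
    by rewrite (chiE A t sA tE) (chiE B t sB tE) eq_chi.
  by rewrite (contraNF (subsetP sA t)) // (contraNF (subsetP sB t)).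
have := card_in_imset Phi_inj; rewrite card_powerset => eq_card.
have sub : Phi @: powerset top_edges \subset setX setT (powerset (tops :\ o)).
  apply/subsetP=> _ /imsetP[A _ ->]; rewrite !inE /=.
  by apply/subsetP=> t; rewrite inE => /andP[].
have := subset_leq_card sub.
rewrite eq_card cardsX cardsT card_ffun !card_ord card_powerset -expnD leq_exp2l //.
by rewrite (cardsD1 o tops) top_o add1n addnS ltnS.
Qed.

(** Otherwise the two bounds on [#|top_edges|] would give [N < n]. *)
Lemma edge_once : n <= N -> exists t, forall t', same_edge t' t -> t' = t %[mod T].
Proof.
move=> le_nN; apply: contrapT => no_t.
suff /leq_tops_top_edges : forall t, exists2 t', t' <> t %[mod T] & same_edge t' t.
  by have := leq_top_edges_rank; lia.
move=> t; apply: contrapT => no_t'; apply: no_t; exists t => t' et; apply: contrapT => neq.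
by apply: no_t'; exists t'.
Qed.

Let word k m := [seq lt i | i <- iota k m].

Lemma eval_word k m : vertex k * eval s (word k m) = vertex (k + m).
Proof.
elim: m k => [|m IHm] k /=; first by rewrite mulg1 addn0.
by rewrite mulgA -vertexS IHm addSnnS.
Qed.

Lemma start_vertex t : start s (vertex t) (lt t) = vertex (source t).
Proof.
by rewrite /start -vertexS /source /src -/(lt t); case: (_.2); rewrite /= ?addn0 ?addn1.
Qed.

Lemma avoids_word p t k m : eval s p = vertex t ->
    (forall i, k <= i < k + m -> ~ same_edge i t) ->
  avoids s Theta p (lt t) (vertex k) (word k m).
Proof.
move=> ep; elim: m k => //= m IHm k not_t; split.
  rewrite /on ep !start_vertex => -[ei ev]; apply: (not_t k); last by split.
  by rewrite leqnn addnS ltnS leq_addr.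
by rewrite -vertexS; apply: IHm => i /andP[ki im]; apply: not_t; lia.
Qed.

Lemma primitive_of_cover : n <= N -> primitive w.
Proof.
move=> /edge_once[t0 once]; pose t := t0 %% T.
have lt_tT : t < T by rewrite ltn_pmod.
have {}once i : i < T -> same_edge i t -> i = t.
  move=> ltiT [ei ev]; rewrite -[LHS](modn_small ltiT) /t; apply: once; split.
    by rewrite ei letter_mod.
  apply: coset_eq_trans ev _; rewrite /source /src -/(lt t) -/(lt t0) letter_mod.
  apply: coset_eq_trans (coset_eq_sym (vertex_mod _)) _.
  by rewrite modnDml; apply: vertex_mod.
pose p := word 0 t; pose q := word t.+1 (T - t.+1).
have ep : eval s p = vertex t by rewrite -[LHS]mul1g -vertex0 eval_word.
apply: (@traversed_once_primitive F n s uniq_s free_s Theta Theta_inj p q (lt t)).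
- rewrite Theta_w eval_cat ep /= mulgA -vertexS eval_word subnKC //.
  by rewrite -[T]addn0 vertex_mulD vertex0 mulg1.
- by rewrite -vertex0; apply: avoids_word => // i lti /once eit; lia.
- by rewrite ep -vertexS; apply: avoids_word => // i lti /once eit; lia.
Qed.

End Cover.

(** * Iterates of the endomorphism and conclusion *)

Lemma morph_iter (G : groupType) (f : {multiplicative G -> G}) (w : G) m k :
    injective f -> f w = w ^+ m ->
  exists2 g : {multiplicative G -> G}, injective g & g w = w ^+ (m ^ k).
Proof.
move=> f_inj fw; elim: k => [|k [g g_inj gw]]; first by exists idfun.
exists (f \o g : {multiplicative G -> G}); first exact: inj_comp.
by rewrite /= gw morphgX fw -expgnA expnS.
Qed.

Lemma morph_expgz (G : groupType) (f : {multiplicative G -> G}) (w : G) d :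
  f w = expgz w d -> f (f w) = w ^+ (`|d| ^ 2).
Proof.
case: d => m fw; rewrite fw /= ?morphgV morphgX fw /=.
  by rewrite -expgnA mulnn.
by rewrite expVgn invgK -expgnA mulnn.
Qed.

Theorem theorem5p3 (n : nat) (F : groupType) (theta : {multiplicative F -> F})
    (w : F) (d : int) :
  (2 <= n)%N ->
  free_of_rank F n ->
  injective theta ->
  w <> 1%g ->
  (2 <= `|d|)%N ->
  theta w = expgz w d ->
  ~ proper_power w ->
  primitive w.
Proof.
move=> n2 freeF theta_inj w1 d2 theta_w npw.
have inj2 : injective (theta \o theta) by apply: inj_comp.
(* Squaring [theta] removes the sign of [d]; the [n]-th iterate of the square raises [w] to the
   power [(d ^ 2) ^ n], which exceeds [n]. *)
have [Theta Theta_inj Theta_w] := morph_iter (f := theta \o theta) n inj2 (morph_expgz theta_w).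
pose l0 : 'I_n * bool := (Ordinal (ltnW n2), true).
have [s [u [h [[uniq_s free_s eu] u0 red_u h_max [h_mod h_inj h_compat]]]]] :=
  stacked_basis l0 w1 npw freeF.
have gt1 : 1 < `|d| ^ 2 by rewrite -mulnn; apply: leq_trans (leq_mul d2 d2).
have gtn : n < (`|d| ^ 2) ^ n by apply: ltn_expl.
rewrite -eu in npw Theta_w *.
apply: (primitive_of_cover uniq_s free_s _ _ npw Theta_inj Theta_w red_u h_max h_mod h_inj h_compat) => //.
  exact: leq_ltn_trans gtn.
exact: ltnW.
Qed.
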